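(* Let $\mu\in\mathcal{P}(\mathbb{R})$ have finite variance $\sigma^2$, and let $a\in\mathbb{R}$, $b\ge2\sigma$. Then $\mathbb{A}_{a,b}(\mu)\in\mathcal{UI}$; in particular $\mathbb{A}_{a,b}(\mu)$ is freely infinitely divisible.
   Context: For $\mu\in\mathcal{P}(\mathbb{R})$: $G_\mu(z)=\int\frac{1}{z-x}\mu(dx)$, $F_\mu=1/G_\mu$ on $\mathbb{C}^+$; $F_\mu$ has a univalent left inverse $F_\mu^{-1}$ on some truncated cone $\Gamma_{\lambda,M}=\{z\in\mathbb{C}^+:|\mathrm{Re}\,z|<\lambda\mathrm{Im}\,z,\ \mathrm{Im}\,z>M\}$. A probability measure $\mu$ is in class $\mathcal{UI}$ if $F_\mu^{-1}$ extends from some $\Gamma_{\lambda,M}$ to a univalent function on $\mathbb{C}^+$ (every measure in $\mathcal{UI}$ is $\boxplus$-infinitely divisible). $\mathbb{A}_\sigma(\mu)$ is the unique probability measure with $\sigma\boxplus\mu=\sigma\rhd\mathbb{A}_\sigma(\mu)$ ($\boxplus$ additive free, $\rhd$ additive monotone convolution, $F_{\mu\rhd\nu}=F_\mu\circ F_\nu$). $\mathbb{A}_{a,b}:=\mathbb{A}_{\mathbf{c}_{a,b}}$ with $\mathbf{c}_{a,b}$ the Cauchy law with density $\frac{b}{\pi((x-a)^2+b^2)}$; equivalently $F_{\mathbb{A}_{a,b}(\mu)}(z)=F_\mu(z-a+ib)+a-ib$. *)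

(* Defs.v *)
From HB Require Import structures.
From mathcomp Require Import all_boot all_order all_algebra.
From mathcomp Require Import all_classical all_reals all_analysis.
From mathcomp Require Import complex.
Set Implicit Arguments. Unset Strict Implicit. Unset Printing Implicit Defensive.
Import Order.TTheory GRing.Theory Num.Theory.
Import numFieldNormedType.Exports.
Local Open Scope classical_set_scope.
Local Open Scope ring_scope.
Local Open Scope complex_scope.

Section ComplexTopology.
Variable R : rcfType.
HB.instance Definition _ := NormedModule.copy R[i] (R[i])^o.
End ComplexTopology.

Section Defs.
Variable R : realType.

Definition upper_half : set R[i] := [set z | 0 < complex.Im z].

Definition cone (lam M : R) : set R[i] :=
  [set z | `|complex.Re z| < lam * complex.Im z /\ M < complex.Im z].

(* Cauchy transform G_mu(z) = int 1/(z-x) mu(dx), written through its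
   real and imaginary parts (the integrands are bounded by 1/Im z). *)
Definition cauchy_transform (mu : probability R R) (z : R[i]) : R[i] :=
  Complex (Rintegral mu setT (fun x => complex.Re ((z - x%:C)^-1)))
          (Rintegral mu setT (fun x => complex.Im ((z - x%:C)^-1))).

Definition F_transform (mu : probability R R) (z : R[i]) : R[i] :=
  (cauchy_transform mu z)^-1.

Definition holomorphic_on (D : set R[i]) (f : R[i] -> R[i]) : Prop :=
  forall z, D z -> exists l : R[i],
    (fun h : R[i] => (f (z + h) - f z) / h) @ (0 : R[i])^' --> l.

(* class UI: the inverse F_mu^{-1} of F_mu defined on some truncated cone
   Gamma_{lam,M} (the branch with values in a cone Gamma_{al,be} on which
   F_mu is univalent) extends to a univalent function on C^+. *)
Definition UI (mu : probability R R) : Prop :=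
  exists (lam M al be : R) (phi : R[i] -> R[i]),
    [/\ 0 < lam, 0 < M, 0 < al & 0 < be] /\
    [/\ {in cone al be &, injective (F_transform mu)},
        (forall z, cone lam M z ->
           cone al be (phi z) /\ F_transform mu (phi z) = z),
        holomorphic_on upper_half phi &
        {in upper_half &, injective phi}].

Definition meas_mean (mu : probability R R) : R := Rintegral mu setT id.
Definition meas_variance (mu : probability R R) : R :=
  Rintegral mu setT (fun x => (x - meas_mean mu) ^+ 2).

End Defs.

(* Main.v *)
(* For [u] in the upper half-plane let [k_u(x) = F(u) / (u - x) - 1], a function
   of mean zero, where [F] is the F-transform of [mu], [m] its mean and [s2] its
   variance.  Then [E |k_u|^2 = Im F(u) / Im u - 1] and
   [F(u) - u + m = E (k_u (m - x))]; bounding the latter by AM-GM gives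
   [|F(u) - u + m| <= s2 / Im u] and [E |k_u|^2 <= s2 / (Im u)^2].  Since
   [F(u) - F(v) = (u - v) (1 + E (k_u k_v))], the map [u |-> w + u - F(u)] is a
   contraction of the half-plane [Im u >= Im w / 2] as soon as
   [Im w > 2 sqrt s2], so [F] has a holomorphic right inverse on
   [Im w > 2 sqrt s2], and translating it by [a - i b] yields the extension of
   the inverse of the F-transform of [nu]. *)
Require Import Defs.
From HB Require Import structures.
From mathcomp Require Import all_boot all_order all_algebra.
From mathcomp Require Import all_classical all_reals all_analysis.
From mathcomp Require Import measurable_realfun complex.
From mathcomp Require Import ring lra.
Import Order.TTheory GRing.Theory Num.Theory.
Import numFieldNormedType.Exports.
Local Open Scope classical_set_scope.
Local Open Scope ring_scope.
Local Open Scope complex_scope.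

Set Implicit Arguments.
Unset Strict Implicit.

(** * Real-valued modulus of complex numbers *)

Section ComplexModulus.
Variable R : realType.
Implicit Types (z w : R[i]) (r : R).
Local Notation N := Normc.normc.

Lemma normc_ge0 z : 0 <= N z.
Proof. by case: z => a b; exact: sqrtr_ge0. Qed.

Lemma normcD_le z w : N (z + w) <= N z + N w.
Proof. exact: le_normcD. Qed.

Lemma normcBC z w : N (z - w) = N (w - z).
Proof. by rewrite -opprB; exact: normcN. Qed.

Lemma normc_sq z : N z ^+ 2 = complex.Re z ^+ 2 + complex.Im z ^+ 2.
Proof. by case: z => a b; rewrite sqr_sqrtr// addr_ge0 ?sqr_ge0. Qed.

Lemma normc_real r : N r%:C = `|r|.
Proof. by rewrite /N /= expr0n addr0 sqrtr_sqr. Qed.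

Lemma normc_gt0 z : z != 0 -> 0 < N z.
Proof.
move=> z0; rewrite lt_neqAle normc_ge0 andbT eq_sym; apply: contra z0.
by move=> /eqP/Normc.eq0_normc ->.
Qed.

Lemma norm_Re_le z : `|complex.Re z| <= N z.
Proof.
by rewrite -(@ler_pXn2r _ 2) ?nnegrE ?normc_ge0// normc_sq real_normK ?num_real//
  lerDl sqr_ge0.
Qed.

Lemma norm_Im_le z : `|complex.Im z| <= N z.
Proof.
by rewrite -(@ler_pXn2r _ 2) ?nnegrE ?normc_ge0// normc_sq real_normK ?num_real//
  lerDr sqr_ge0.
Qed.

Lemma normc_le z : N z <= `|complex.Re z| + `|complex.Im z|.
Proof.
rewrite -(@ler_pXn2r _ 2) ?nnegrE ?normc_ge0 ?addr_ge0// normc_sq.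
rewrite -(real_normK (num_real (complex.Re z))) -(real_normK (num_real (complex.Im z))).
have := normr_ge0 (complex.Re z); have := normr_ge0 (complex.Im z); nra.
Qed.

(** The norm that defines the topology of [R[i]] takes values in [R[i]]; this identity lets every
    estimate be made with the real-valued modulus instead. *)
Lemma complex_normE z : `|z| = (N z)%:C.
Proof. by case: z => a b; rewrite normc_def. Qed.

Lemma ReD z w : complex.Re (z + w) = complex.Re z + complex.Re w.
Proof. by case: z w => [a b] [c d]. Qed.

Lemma ImD z w : complex.Im (z + w) = complex.Im z + complex.Im w.
Proof. by case: z w => [a b] [c d]. Qed.

Lemma ReM z w : complex.Re (z * w) =
  complex.Re z * complex.Re w - complex.Im z * complex.Im w.
Proof. by case: z w => [a b] [c d]. Qed.

Lemma ImM z w : complex.Im (z * w) =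
  complex.Re z * complex.Im w + complex.Im z * complex.Re w.
Proof. by case: z w => [a b] [c d]. Qed.

Lemma ReN z : complex.Re (- z) = - complex.Re z.
Proof. by case: z. Qed.

Lemma ImN z : complex.Im (- z) = - complex.Im z.
Proof. by case: z. Qed.

Lemma ImV z : complex.Im z^-1 = - complex.Im z / N z ^+ 2.
Proof. by rewrite normc_sq mulNr; case: z. Qed.

End ComplexModulus.

(** * Expectation of complex-valued functions *)

Section ComplexExpectation.
Variables (R : realType) (mu : probability R R).
Implicit Types (f g : R -> R[i]) (c : R[i]) (h : R -> R).
Local Notation N := Normc.normc.

Definition cintegrable g :=
  mu.-integrable setT (EFin \o (fun x => complex.Re (g x))) /\
  mu.-integrable setT (EFin \o (fun x => complex.Im (g x))).

(** Taken part by part exactly as in [cauchy_transform], so that the Cauchy transform is by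
    definition the expectation of its kernel. *)
Definition cexpect g : R[i] :=
  Complex (Rintegral mu setT (fun x => complex.Re (g x)))
          (Rintegral mu setT (fun x => complex.Im (g x))).

Lemma integrableD_EFin (h1 h2 : R -> R) :
  mu.-integrable setT (EFin \o h1) -> mu.-integrable setT (EFin \o h2) ->
  mu.-integrable setT (EFin \o (fun x => h1 x + h2 x)).
Proof. by move=> i1 i2; exact: (integrableD measurableT i1 i2). Qed.

Lemma integrableZl_EFin r h : mu.-integrable setT (EFin \o h) ->
  mu.-integrable setT (EFin \o (fun x => r * h x)).
Proof. by move=> i1; exact: (integrableZl measurableT r i1). Qed.

Lemma integrable_cst_EFin r : mu.-integrable setT (EFin \o (fun=> r : R)).
Proof. exact: finite_measure_integrable_cst. Qed.

Lemma expect_cst r : Rintegral mu setT (fun=> r) = r.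
Proof. by rewrite Rintegral_cst// [X in fine X]probability_setT mulr1. Qed.

Lemma eq_cexpect f g : f =1 g -> cexpect f = cexpect g.
Proof. by move=> /funext ->. Qed.

Lemma eq_cintegrable f g : f =1 g -> cintegrable f -> cintegrable g.
Proof. by move=> /funext ->. Qed.

Lemma cintegrable_cst c : cintegrable (fun=> c).
Proof. by split; exact: integrable_cst_EFin. Qed.

Lemma cexpect_cst c : cexpect (fun=> c) = c.
Proof. by case: c => a b; rewrite /cexpect !expect_cst. Qed.

Lemma cintegrableD f g : cintegrable f -> cintegrable g ->
  cintegrable (fun x => f x + g x).
Proof.
move=> [f1 f2] [g1 g2]; split.
  under eq_fun do rewrite ReD; exact: integrableD_EFin.
under eq_fun do rewrite ImD; exact: integrableD_EFin.
Qed.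

Lemma cexpectD f g : cintegrable f -> cintegrable g ->
  cexpect (fun x => f x + g x) = cexpect f + cexpect g.
Proof.
move=> [f1 f2] [g1 g2]; rewrite /cexpect.
under eq_Rintegral do rewrite ReD.
under [in X in _ +i* X]eq_Rintegral do rewrite ImD.
by rewrite !RintegralD.
Qed.

Lemma cintegrableZ c g : cintegrable g -> cintegrable (fun x => c * g x).
Proof.
move=> [g1 g2]; split.
  under eq_fun do rewrite ReM -mulNr.
  by apply: integrableD_EFin; exact: integrableZl_EFin.
under eq_fun do rewrite ImM.
by apply: integrableD_EFin; exact: integrableZl_EFin.
Qed.

Lemma cexpectZ c g : cintegrable g ->
  cexpect (fun x => c * g x) = c * cexpect g.
Proof.
move=> [g1 g2]; rewrite /cexpect.
under eq_Rintegral do rewrite ReM -mulNr.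
under [in X in _ +i* X]eq_Rintegral do rewrite ImM.
rewrite !RintegralD//; try exact: integrableZl_EFin.
by rewrite !RintegralZl//; case: c => a b /=; rewrite mulNr.
Qed.

Lemma cintegrableB f g : cintegrable f -> cintegrable g ->
  cintegrable (fun x => f x - g x).
Proof.
move=> fi gi; apply: (@eq_cintegrable (fun x => f x + -1 * g x)).
  by move=> x; rewrite mulN1r.
by apply: cintegrableD => //; exact: cintegrableZ.
Qed.

Lemma cexpectB f g : cintegrable f -> cintegrable g ->
  cexpect (fun x => f x - g x) = cexpect f - cexpect g.
Proof.
move=> fi gi; rewrite (@eq_cexpect _ (fun x => f x + -1 * g x)); last first.
  by move=> x; rewrite mulN1r.
by rewrite cexpectD// ?cexpectZ ?mulN1r//; exact: cintegrableZ.
Qed.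

(* Rotating by the conjugate of [cexpect g] reduces to the real inequality. *)
Lemma normc_cexpect_le g h : cintegrable g -> mu.-integrable setT (EFin \o h) ->
  (forall x, N (g x) <= h x) -> N (cexpect g) <= Rintegral mu setT h.
Proof.
move=> gi hi gh.
have h0 : 0 <= Rintegral mu setT h.
  by apply: Rintegral_ge0 => x _; exact: le_trans (normc_ge0 _) (gh x).
have [E0|E0] := eqVneq (cexpect g) 0; first by rewrite E0 Normc.normc0.
set w := cexpect g in E0 *; have w0 := normc_gt0 E0.
suff : N w ^+ 2 <= N w * Rintegral mu setT h.
  by rewrite expr2 ler_pM2l.
have -> : N w ^+ 2 = complex.Re (cexpect (fun x => w^* * g x)).
  by rewrite cexpectZ// -/w normc_sq; case: (w) => a b /=; ring.
have [i1 _] := cintegrableZ (w^*) gi.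
rewrite -RintegralZl//= le_Rintegral//.
  exact: integrableZl_EFin.
move=> x _; apply: le_trans (ler_norm _) _; apply: le_trans (norm_Re_le _) _.
rewrite Normc.normcM; have -> : N w^* = N w.
  by case: (w) => a b; rewrite /N /= sqrrN.
by rewrite ler_wpM2l// ?normc_ge0.
Qed.

Lemma integrable_bounded_EFin h (C : R) : measurable_fun setT h ->
  (forall x, `|h x| <= C) -> mu.-integrable setT (EFin \o h).
Proof.
move=> mh hC; apply: (@le_integrable _ _ _ _ _ _ _ (EFin \o (fun=> C))) => //.
- exact/measurable_EFinP.
- by move=> x _ /=; rewrite lee_fin (le_trans (hC x))// ler_norm.
- exact: integrable_cst_EFin.
Qed.

Lemma cintegrable_bounded g (C : R) :
  measurable_fun setT (fun x => complex.Re (g x)) ->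
  measurable_fun setT (fun x => complex.Im (g x)) ->
  (forall x, N (g x) <= C) -> cintegrable g.
Proof.
move=> m1 m2 gC; split; apply: (@integrable_bounded_EFin _ C) => // x.
  exact: le_trans (norm_Re_le _) (gC x).
exact: le_trans (norm_Im_le _) (gC x).
Qed.

End ComplexExpectation.

(** * The Cauchy kernel and the Cauchy transform *)

Section CauchyKernel.
Variable R : realType.
Implicit Types (u v : R[i]) (x y : R).
Local Notation N := Normc.normc.

Definition cauchy_kernel u x : R[i] := (u - x%:C)^-1.

Lemma Im_subr_real u x : complex.Im (u - x%:C) = complex.Im u.
Proof. by case: u => a b /=; rewrite subr0. Qed.

Lemma cauchy_kernel_den_neq0 u x : 0 < complex.Im u -> u - x%:C != 0.
Proof.
move=> u0; apply/eqP => /(congr1 (@complex.Im _)); rewrite Im_subr_real => u1.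
by rewrite u1 ltxx in u0.
Qed.

Lemma normc_cauchy_kernel_le u x :
  0 < complex.Im u -> N (cauchy_kernel u x) <= (complex.Im u)^-1.
Proof.
move=> u0; rewrite Normc.normcV lef_pV2 ?posrE ?normc_gt0 ?cauchy_kernel_den_neq0//.
apply: le_trans (norm_Im_le _); rewrite Im_subr_real; exact: ler_norm.
Qed.

Lemma Im_cauchy_kernel u x :
  complex.Im (cauchy_kernel u x) = - complex.Im u * N (cauchy_kernel u x) ^+ 2.
Proof. by rewrite ImV Im_subr_real Normc.normcV exprVn. Qed.

Lemma measurable_cauchy_kernel u : 0 < complex.Im u ->
  measurable_fun setT (fun x => complex.Re (cauchy_kernel u x)) /\
  measurable_fun setT (fun x => complex.Im (cauchy_kernel u x)).
Proof.
case: u => a b /= b0.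
have cden : continuous (fun x : R => ((a - x) ^+ 2 + b ^+ 2)^-1).
  move=> x; apply: cvgV; first by rewrite gt_eqF// ltr_wpDl ?sqr_ge0 ?exprn_gt0.
  apply: cvgD; last exact: cvg_cst.
  apply: (@continuous_comp _ _ _ (fun x => a - x) (fun x => x ^+ 2)).
    by apply: cvgB; [exact: cvg_cst|exact: cvg_id].
  exact: exprn_continuous.
split.
  have -> : (fun x => complex.Re (cauchy_kernel (a +i* b) x)) =
            (fun x => (a - x) * ((a - x) ^+ 2 + b ^+ 2)^-1).
    by apply/funext => x; rewrite /= subr0.
  apply: continuous_measurable_fun => x; apply: cvgM; last exact: cden.
  by apply: cvgB; [exact: cvg_cst|exact: cvg_id].
have -> : (fun x => complex.Im (cauchy_kernel (a +i* b) x)) =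
          (fun x => - (b * ((a - x) ^+ 2 + b ^+ 2)^-1)).
  by apply/funext => x; rewrite /= subr0.
apply: continuous_measurable_fun => x; apply: cvgN; apply: cvgM; last exact: cden.
exact: cvg_cst.
Qed.

(** Resolvent identity: it factors [u - v] out of differences of Cauchy transforms. *)
Lemma cauchy_kernelB u v x : 0 < complex.Im u -> 0 < complex.Im v ->
  cauchy_kernel v x - cauchy_kernel u x =
  (u - v) * (cauchy_kernel u x * cauchy_kernel v x).
Proof.
move=> u0 v0; have := cauchy_kernel_den_neq0 x u0.
have := cauchy_kernel_den_neq0 x v0; rewrite /cauchy_kernel => v1 u1.
by field; rewrite v1 u1.
Qed.

Variable mu : probability R R.
Local Notation E := (cexpect mu).

Lemma cintegrable_kernel u : 0 < complex.Im u -> cintegrable mu (cauchy_kernel u).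
Proof.
move=> u0; have [m1 m2] := measurable_cauchy_kernel u0.
by apply: cintegrable_bounded m1 m2 _ => x; exact: normc_cauchy_kernel_le.
Qed.

Lemma cintegrable_kernelM u v : 0 < complex.Im u -> 0 < complex.Im v ->
  cintegrable mu (fun x => cauchy_kernel u x * cauchy_kernel v x).
Proof.
move=> u0 v0; have [m1 m2] := measurable_cauchy_kernel u0.
have [m3 m4] := measurable_cauchy_kernel v0.
apply: (@cintegrable_bounded _ _ _ ((complex.Im u)^-1 * (complex.Im v)^-1)).
- under eq_fun do rewrite ReM.
  by apply: measurable_funB; exact: measurable_funM.
- under eq_fun do rewrite ImM.
  by apply: measurable_funD; exact: measurable_funM.
- move=> x; rewrite Normc.normcM.
  by rewrite ler_pM ?normc_ge0 ?normc_cauchy_kernel_le.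
Qed.

Lemma cauchy_transformE u : cauchy_transform mu u = E (cauchy_kernel u).
Proof. by []. Qed.

Lemma cauchy_transformB u v : 0 < complex.Im u -> 0 < complex.Im v ->
  cauchy_transform mu v - cauchy_transform mu u =
  (u - v) * E (fun x => cauchy_kernel u x * cauchy_kernel v x).
Proof.
move=> u0 v0; rewrite !cauchy_transformE.
rewrite -cexpectB; [|exact: cintegrable_kernel..].
rewrite -cexpectZ; last exact: cintegrable_kernelM.
by apply: eq_cexpect => x; exact: cauchy_kernelB.
Qed.

Lemma normc_cexpect_bounded g (C : R) : cintegrable mu g ->
  (forall x, N (g x) <= C) -> N (E g) <= C.
Proof.
move=> gi gC; rewrite -[leRHS](expect_cst mu).
by apply: normc_cexpect_le => //; exact: integrable_cst_EFin.
Qed.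

Lemma normc_cexpect_kernelM_le u v : 0 < complex.Im u -> 0 < complex.Im v ->
  N (E (fun x => cauchy_kernel u x * cauchy_kernel v x)) <=
  (complex.Im u)^-1 * (complex.Im v)^-1.
Proof.
move=> u0 v0; apply: normc_cexpect_bounded; first exact: cintegrable_kernelM.
by move=> x; rewrite Normc.normcM ler_pM ?normc_ge0 ?normc_cauchy_kernel_le.
Qed.

(** A second use of the resolvent identity, on the factor that varies. This continuity estimate
    identifies the derivative of the inverse of [F]. *)
Lemma cexpect_kernelM_lip u v : 0 < complex.Im u -> 0 < complex.Im v ->
  N (E (fun x => cauchy_kernel u x * cauchy_kernel v x) -
     E (fun x => cauchy_kernel v x * cauchy_kernel v x)) <=
  N (u - v) * ((complex.Im u)^-1 * (complex.Im v)^-1 ^+ 2).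
Proof.
move=> u0 v0; have i1 := cintegrable_kernelM u0 v0.
have i2 := cintegrable_kernelM v0 v0.
rewrite -cexpectB//; apply: normc_cexpect_bounded; first exact: cintegrableB.
move=> x; rewrite -mulrBl cauchy_kernelB// normcBC.
rewrite !Normc.normcM -mulrA ler_wpM2l ?normc_ge0//.
have := normc_cauchy_kernel_le x u0; have := normc_cauchy_kernel_le x v0.
have := normc_ge0 (cauchy_kernel u x); have := normc_ge0 (cauchy_kernel v x).
set p := N _; set q := N _ => p0 q0 pv qu.
by rewrite [p * q]mulrC -mulrA expr2 ler_pM ?mulr_ge0// ler_pM.
Qed.

End CauchyKernel.

(** * The F-transform of a measure of finite variance *)

Section FTransformFiniteVariance.
Variables (R : realType) (mu : probability R R).
Hypothesis mu_sq : mu.-integrable setT (fun x : R => ((x ^+ 2)%:E)%E).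
Implicit Types (u v : R[i]) (x t : R).
Local Notation N := Normc.normc.
Local Notation E := (cexpect mu).
Local Notation F := (F_transform mu).
Local Notation G := (cauchy_transform mu).
Local Notation m := (meas_mean mu).
Local Notation s2 := (meas_variance mu).

Lemma integrable_id : mu.-integrable setT (EFin \o (fun x : R => x)).
Proof.
apply: (@le_integrable _ _ _ _ _ _ _ (EFin \o (fun x => 1 + x ^+ 2))) => //.
- by apply/measurable_EFinP; exact: measurable_id.
- move=> x _; rewrite /= lee_fin; apply: le_trans (ler_norm _).
  rewrite -(real_normK (num_real x)).
  (* Completing the square gives [|x| <= x^2 + 1/4]. *)
  by have := sqr_ge0 (`|x| - 2^-1); nra.
- by apply: integrableD_EFin => //; exact: integrable_cst_EFin.
Qed.

Lemma integrable_sq_dist (c : R) :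
  mu.-integrable setT (EFin \o (fun x => (x - c) ^+ 2)).
Proof.
have -> : (fun x : R => (x - c) ^+ 2) = (fun x => x ^+ 2 + ((- 2 * c) * x + c ^+ 2)).
  by apply/funext => x; ring.
apply: integrableD_EFin => //; apply: integrableD_EFin.
  by apply: integrableZl_EFin; exact: integrable_id.
exact: integrable_cst_EFin.
Qed.

Lemma meas_variance_ge0 : 0 <= s2.
Proof. by apply: Rintegral_ge0 => x _; exact: sqr_ge0. Qed.

Lemma cintegrable_real : cintegrable mu (fun x => x%:C).
Proof. by split; [exact: integrable_id|exact: integrable_cst_EFin]. Qed.

Lemma cexpect_real : E (fun x => x%:C) = m%:C.
Proof. by rewrite /cexpect /= expect_cst. Qed.

(* Jensen's inequality in the form [1/w >= 2/C - w/C^2] with [C] the mean of [w]. *)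
Lemma Im_cauchy_transform_lt0 u : 0 < complex.Im u -> complex.Im (G u) < 0.
Proof.
move=> u0; set y := complex.Im u; set a := complex.Re u.
pose w x := (x - a) ^+ 2 + y ^+ 2.
have wi : mu.-integrable setT (EFin \o w).
  apply: integrableD_EFin; first exact: integrable_sq_dist.
  exact: integrable_cst_EFin.
have w0 x : 0 < w x by rewrite ltr_wpDl ?sqr_ge0 ?exprn_gt0.
pose C := Rintegral mu setT w.
have C0 : 0 < C.
  apply: (@lt_le_trans _ _ (y ^+ 2)); first by rewrite exprn_gt0.
  rewrite -[leLHS](expect_cst mu) le_Rintegral//.
    exact: integrable_cst_EFin.
  by move=> x _; rewrite lerDr sqr_ge0.
have [_ fi] := cintegrable_kernel mu u0.
suff : complex.Im (G u) <= - (y / C).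
  by move=> /le_lt_trans; apply; rewrite oppr_lt0 divr_gt0.
have -> : - (y / C) = Rintegral mu setT (fun x => y / C ^+ 2 * w x + - (2 * y / C)).
  rewrite RintegralD//; [|exact: integrableZl_EFin|exact: integrable_cst_EFin].
  by rewrite RintegralZl// expect_cst -/C; field; rewrite gt_eqF.
apply: le_Rintegral => //.
  apply: integrableD_EFin; first exact: integrableZl_EFin.
  exact: integrable_cst_EFin.
move=> x _; rewrite Im_cauchy_kernel -/y Normc.normcV exprVn normc_sq.
rewrite Im_subr_real -/y.
have -> : complex.Re (u - x%:C) ^+ 2 + y ^+ 2 = w x.
  by rewrite /w ReD ReN /= -/a; ring.
rewrite -subr_ge0.
have -> : y / C ^+ 2 * w x + - (2 * y / C) - - y * (w x)^-1 =
          y * (w x - C) ^+ 2 / (C ^+ 2 * w x).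
  move: (w x) (w0 x) C C0 => w' w'0 C' C'0.
  by field; rewrite (gt_eqF w'0) (gt_eqF C'0).
by apply: divr_ge0; apply: mulr_ge0; rewrite ?sqr_ge0// ltW.
Qed.

Lemma cauchy_transform_neq0 u : 0 < complex.Im u -> G u != 0.
Proof. by move=> /Im_cauchy_transform_lt0; apply: contraTneq => ->; rewrite ltxx. Qed.

Lemma F_transformM u : 0 < complex.Im u -> F u * G u = 1.
Proof. by move=> u0; rewrite mulVf// cauchy_transform_neq0. Qed.

Definition centered_kernel u x := F u * cauchy_kernel u x - 1.
Local Notation k := centered_kernel.

Lemma cintegrable_centered u : 0 < complex.Im u -> cintegrable mu (k u).
Proof.
move=> u0; apply: cintegrableB; last exact: cintegrable_cst.
by apply: cintegrableZ; exact: cintegrable_kernel.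
Qed.

Lemma cexpect_centered u : 0 < complex.Im u -> E (k u) = 0.
Proof.
move=> u0; have fi := cintegrable_kernel mu u0.
rewrite cexpectB; [|exact: cintegrableZ|exact: cintegrable_cst].
by rewrite cexpectZ// cexpect_cst -cauchy_transformE F_transformM// subrr.
Qed.

Definition centered_var u := Rintegral mu setT (fun x => N (k u x) ^+ 2).

(* Since [|f|^2 = - Im f / Im u] for the Cauchy kernel [f = 1 / (u - x)], the
   square [|F f - 1|^2] is the real part of an affine function of [f]. *)
Let lincoef u : R[i] := 0 +i* (N (F u) ^+ 2 / complex.Im u) - 2 * F u.

Lemma normc_sq_centered u x : 0 < complex.Im u ->
  N (k u x) ^+ 2 = complex.Re (lincoef u * cauchy_kernel u x + 1).
Proof.
move=> u0; have := Im_cauchy_kernel u x; rewrite normc_sq.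
rewrite /k /lincoef [N (F u) ^+ 2]normc_sq; set y := complex.Im u in u0 *.
case: (F u) (cauchy_kernel u x) => p q [s t] ht; rewrite /= in ht.
have ht' : (s ^+ 2 + t ^+ 2) * y = - t by rewrite {2}ht; ring.
have -> : N ((p +i* q) * (s +i* t) - 1) ^+ 2 =
  (p ^+ 2 + q ^+ 2) * (s ^+ 2 + t ^+ 2) - 2 * (p * s - q * t) + 1.
  by rewrite normc_sq ReD ImD ReM ImM /=; ring.
have -> : s ^+ 2 + t ^+ 2 = - t / y by rewrite -ht' mulfK// gt_eqF.
by rewrite ReD !ReM ReD ImD ReN ReM /=; field; rewrite gt_eqF.
Qed.


Lemma integrable_sq_centered u : 0 < complex.Im u ->
  mu.-integrable setT (EFin \o (fun x => N (k u x) ^+ 2)).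
Proof.
move=> u0; under eq_fun do rewrite normc_sq_centered//.
have [//] : cintegrable mu (fun x => lincoef u * cauchy_kernel u x + 1).
apply: cintegrableD; last exact: cintegrable_cst.
by apply: cintegrableZ; exact: cintegrable_kernel.
Qed.

(** The integrand is the real part of an affine function of the kernel, so its mean depends on [G u]
    only; then [F u * G u = 1] and [Im F = - Im G * |F|^2] simplify it. *)
Lemma centered_varE u : 0 < complex.Im u ->
  centered_var u = complex.Im (F u) / complex.Im u - 1.
Proof.
move=> u0; have fi := cintegrable_kernel mu u0.
have -> : centered_var u =
    complex.Re (E (fun x => lincoef u * cauchy_kernel u x + 1)).
  by apply: eq_Rintegral => x _; rewrite normc_sq_centered.
rewrite cexpectD; [|exact: cintegrableZ|exact: cintegrable_cst].
rewrite cexpectZ// cexpect_cst -cauchy_transformE /lincoef mulrBl -[2 * _ * _]mulrA.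
rewrite F_transformM//.
have -> : complex.Im (F u) = - complex.Im (G u) * N (F u) ^+ 2.
  by rewrite ImV Normc.normcV exprVn.
rewrite !ReD ReN !ReM /=.
by field; rewrite gt_eqF.
Qed.

Lemma cintegrable_centeredM u v : 0 < complex.Im u -> 0 < complex.Im v ->
  cintegrable mu (fun x => k u x * k v x).
Proof.
move=> u0 v0.
apply: (@eq_cintegrable _ _ (fun x =>
    F u * F v * (cauchy_kernel u x * cauchy_kernel v x) - k u x - k v x - 1)).
  by move=> x; rewrite /k; ring.
apply: cintegrableB; last exact: cintegrable_cst.
apply: cintegrableB; last exact: cintegrable_centered.
apply: cintegrableB; last exact: cintegrable_centered.
by apply: cintegrableZ; exact: cintegrable_kernelM.
Qed.

(** The left integrand, with its factors [F u] and [F v], is [(1 + k u) * (1 + k v)], and the linear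
    terms have mean zero. *)
Lemma cexpect_centeredM u v : 0 < complex.Im u -> 0 < complex.Im v ->
  F u * F v * E (fun x => cauchy_kernel u x * cauchy_kernel v x) =
  1 + E (fun x => k u x * k v x).
Proof.
move=> u0 v0; have ki := cintegrable_centeredM u0 v0.
have ui := cintegrable_centered u0; have vi := cintegrable_centered v0.
rewrite -cexpectZ; last exact: cintegrable_kernelM.
rewrite (@eq_cexpect _ _ _ (fun x => k u x * k v x + (k u x + (k v x + 1)))).
  have i1 := cintegrable_cst mu 1; have i2 := cintegrableD vi i1.
  have i3 := cintegrableD ui i2.
  rewrite (cexpectD ki i3) (cexpectD ui i2) (cexpectD vi i1).
  by rewrite (cexpect_centered u0) (cexpect_centered v0) cexpect_cst !add0r addrC.
by move=> x; rewrite /k; ring.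
Qed.

(** From [F u - F v = F u * F v * (G v - G u)] and the resolvent identity. The correlation of [k u]
    and [k v] thus measures how far [F] is from a translation. *)
Lemma F_transformB u v : 0 < complex.Im u -> 0 < complex.Im v ->
  F u - F v = (u - v) * (1 + E (fun x => k u x * k v x)).
Proof.
move=> u0 v0; rewrite -cexpect_centeredM//.
rewrite mulrCA -cauchy_transformB//.
have := cauchy_transform_neq0 u0; have := cauchy_transform_neq0 v0.
by rewrite /F_transform => v1 u1; field; rewrite v1 u1.
Qed.

Lemma normc_cexpect_centeredM_le u v : 0 < complex.Im u -> 0 < complex.Im v ->
  N (E (fun x => k u x * k v x)) <= (centered_var u + centered_var v) / 2.
Proof.
move=> u0 v0; have iu := integrable_sq_centered u0.
have iv := integrable_sq_centered v0.
have -> : (centered_var u + centered_var v) / 2 =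
    Rintegral mu setT (fun x => 2^-1 * (N (k u x) ^+ 2 + N (k v x) ^+ 2)).
  by rewrite RintegralZl ?RintegralD 1?mulrC//; exact: integrableD_EFin.
apply: normc_cexpect_le; first exact: cintegrable_centeredM.
  by apply: integrableZl_EFin; exact: integrableD_EFin.
move=> x; rewrite Normc.normcM; have := sqr_ge0 (N (k u x) - N (k v x)); nra.
Qed.

(** Since [k u x * (u - x) = F u - u + x], writing [m - x = (m - u) + (u - x)] gives the pointwise
    identity [kE]; its expectation kills [k u] and turns [x] into [m]. *)
Lemma F_transform_residual u : 0 < complex.Im u ->
  cintegrable mu (fun x => k u x * (m - x)%:C) /\
  F u - u + m%:C = E (fun x => k u x * (m - x)%:C).
Proof.
move=> u0.
have kE x : (F u - u) + x%:C + (m%:C - u) * k u x = k u x * (m - x)%:C.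
  have := cauchy_kernel_den_neq0 x u0.
  by rewrite /k /cauchy_kernel rmorphB /= => u1; field.
have i1 := cintegrable_cst mu (F u - u); have i2 := cintegrable_real.
have i3 := cintegrable_centered u0; have i4 := cintegrableZ (m%:C - u) i3.
have i5 := cintegrableD i1 i2.
split; first by apply: eq_cintegrable kE _; exact: cintegrableD.
rewrite -(eq_cexpect _ kE) (cexpectD i5 i4) (cexpectD i1 i2).
rewrite (cexpectZ _ i3) (cexpect_centered u0).
by rewrite mulr0 addr0 cexpect_cst cexpect_real.
Qed.

(** A self-improving bound. With [D] the residual, [y = Im u] and [V] the centered variance,
    weighted AM-GM gives [|D| <= (y V + s2 / y) / 2]. But [y V = Im D <= |D|], so this half is
    absorbed on the left. *)
Lemma normc_residual_le u : 0 < complex.Im u ->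
  N (F u - u + m%:C) <= s2 / complex.Im u.
Proof.
move=> u0; have [ki kE] := F_transform_residual u0.
set y := complex.Im u in u0 *.
suff D_le : N (F u - u + m%:C) <= (y * centered_var u + s2 / y) / 2.
  move: D_le; rewrite centered_varE// -/y.
  have -> : y * (complex.Im (F u) / y - 1) = complex.Im (F u - u + m%:C).
    rewrite mulrBr mulr1 mulrCA mulfV ?gt_eqF// mulr1 !ImD.
    by rewrite ImN /= addr0.
  by have := le_trans (ler_norm _) (norm_Im_le (F u - u + m%:C)); lra.
have i1 := integrable_sq_centered u0; have i2 := integrable_sq_dist m.
have -> : (y * centered_var u + s2 / y) / 2 = Rintegral mu setT (fun x =>
    (y / 2) * N (k u x) ^+ 2 + (2 * y)^-1 * (x - m) ^+ 2).
  rewrite RintegralD//; try exact: integrableZl_EFin.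
  by rewrite !RintegralZl// -/(centered_var u) -/s2; field; rewrite gt_eqF.
rewrite kE; apply: normc_cexpect_le => //.
  by apply: integrableD_EFin; exact: integrableZl_EFin.
move=> x; rewrite Normc.normcM normc_real distrC -(real_normK (num_real (x - m))).
move: (N _) `|_| => p q; rewrite -subr_ge0.
have -> : y / 2 * p ^+ 2 + (2 * y)^-1 * q ^+ 2 - p * q = (y * p - q) ^+ 2 / (2 * y).
  by field; rewrite gt_eqF.
by rewrite divr_ge0 ?sqr_ge0// mulr_ge0// ltW.
Qed.

(** The centered variance is the imaginary part of the residual divided by [Im u], the shift by [m]
    being real. *)
Lemma centered_var_le u : 0 < complex.Im u -> centered_var u <= s2 / complex.Im u ^+ 2.
Proof.
move=> u0; rewrite centered_varE//.
have : complex.Im (F u) - complex.Im u <= s2 / complex.Im u.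
  apply: le_trans (normc_residual_le u0); apply: le_trans (norm_Im_le _).
  by apply: le_trans (ler_norm _); rewrite !ImD ImN addr0.
move: (complex.Im (F u)) (complex.Im u) u0 => p y y0 h.
have -> : p / y - 1 = (p - y) / y by field; rewrite gt_eqF.
by rewrite ler_pdivrMr// expr2 invfM mulrA divfK ?gt_eqF.
Qed.

(** Provides the contraction constant [s2 / t^2] on the half-plane [Im >= t]. *)
Lemma normc_cexpect_centeredM t u v :
  0 < t -> t <= complex.Im u -> t <= complex.Im v ->
  N (E (fun x => k u x * k v x)) <= s2 / t ^+ 2.
Proof.
move=> t0 tu tv; have u0 := lt_le_trans t0 tu; have v0 := lt_le_trans t0 tv.
apply: le_trans (normc_cexpect_centeredM_le u0 v0) _.
have le_t w : t <= complex.Im w -> centered_var w <= s2 / t ^+ 2.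
  move=> tw; have w0 := lt_le_trans t0 tw.
  apply: le_trans (centered_var_le w0) _; apply: ler_wpM2l; first exact: meas_variance_ge0.
  by rewrite lef_pV2 ?posrE ?exprn_gt0// lerXn2r ?nnegrE ?(ltW t0) ?(ltW w0).
by have := le_t _ tu; have := le_t _ tv; lra.
Qed.

End FTransformFiniteVariance.

(** * Fixed points of contractions of a half-plane; a criterion for complex limits *)

Section HalfPlaneFixedPoint.
Variable R : realType.
Local Notation N := Normc.normc.

(** The telescoping series is dominated by a geometric one. It is applied to real and imaginary
    parts separately, so only completeness of the reals is used. *)
Lemma cvgn_geometric_steps (a : nat -> R) (C q : R) : 0 <= q < 1 ->
  (forall n, `|a n.+1 - a n| <= C * q ^+ n) -> cvgn a.
Proof.
move=> /andP[q0 q1] ha.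
have -> : a = (fun n => a 0%N + series (telescope a) n).
  by apply/funext => n; exact: eq_sum_telescope.
apply: is_cvgD; first exact: is_cvg_cst.
apply: normed_cvg; apply: (@series_le_cvg _ _ (geometric C q)) => //.
- by move=> n; exact: normr_ge0.
- by move=> n; exact: le_trans (normr_ge0 _) (ha n).
- by apply: is_cvg_geometric_series; rewrite ger0_norm.
Qed.

(** Banach's argument, iterating from the boundary point [i t]; the half-plane is closed, so the
    limit stays in it. *)
Lemma half_plane_fixed_point (T : R[i] -> R[i]) (t q : R) : 0 <= q < 1 ->
  (forall u, t <= complex.Im u -> t <= complex.Im (T u)) ->
  (forall u v, t <= complex.Im u -> t <= complex.Im v ->
     N (T u - T v) <= q * N (u - v)) ->
  exists2 u, t <= complex.Im u & T u = u.
Proof.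
move=> q01 Tt Tq; have /andP[q0 q1] := q01; pose s n := iter n T (0 +i* t).
have sS n : s n.+1 = T (s n) by [].
have st n : t <= complex.Im (s n) by elim: n => [|n IH] //=; exact: Tt.
have step n : N (s n.+1 - s n) <= N (s 1%N - s 0%N) * q ^+ n.
  elim: n => [|n IH]; first by rewrite expr0 mulr1.
  rewrite sS [X in T _ - X]sS; apply: le_trans (Tq _ _ (st _) (st _)) _.
  by rewrite exprS mulrCA ler_wpM2l.
have cRe : cvgn (fun n => complex.Re (s n)).
  apply: cvgn_geometric_steps q01 _ => n; rewrite -ReN -ReD.
  exact: le_trans (norm_Re_le _) (step n).
have cIm : cvgn (fun n => complex.Im (s n)).
  apply: cvgn_geometric_steps q01 _ => n; rewrite -ImN -ImD.
  exact: le_trans (norm_Im_le _) (step n).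
set u := limn (fun n => complex.Re (s n)) +i* limn (fun n => complex.Im (s n)).
have ut : t <= complex.Im u.
  by apply: limr_ge => //; apply: nearW => n; exact: st.
exists u => //.
pose d n := `|complex.Re (s n) - complex.Re u| + `|complex.Im (s n) - complex.Im u|.
have dist0 (x : nat -> R) : cvgn x -> (fun n => `|x n - limn x|) @ \oo --> (0 : R).
  move=> cx; rewrite -(normr0 R) -(subrr (limn x)); apply: cvg_norm.
  by apply: cvgB => //; exact: cvg_cst.
have d0 : d @ \oo --> (0 : R).
  by rewrite -[0]addr0; apply: cvgD; exact: dist0.
have ds n : N (s n - u) <= d n.
  by apply: le_trans (normc_le _) _; rewrite ReD ImD ReN ImN.
(* Pass through [T (s n) = s n.+1]; the contraction bounds the first half by [d n]. *)
have Tu n : N (T u - u) <= d n + d n.+1.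
  rewrite -(subrK (T (s n)) (T u)) -addrA.
  apply: le_trans (normcD_le _ _) _; apply: lerD; last by rewrite -sS; exact: ds.
  rewrite normcBC; apply: le_trans (Tq _ _ (st _) ut) _.
  by apply: le_trans (ds n); rewrite ler_piMl ?normc_ge0 ?ltW.
have dd0 : (fun n => d n + d n.+1) @ \oo --> (0 : R).
  by rewrite -[0]addr0; apply: cvgD => //; rewrite cvg_shiftS.
have : N (T u - u) <= 0.
  rewrite -(cvg_lim (@Rhausdorff R) dd0); apply: limr_ge; first exact: cvgP dd0.
  by apply: nearW.
move=> h; apply/eqP; rewrite -subr_eq0; apply/eqP/Normc.eq0_normc.
by apply/eqP; rewrite eq_le h normc_ge0.
Qed.

(** Turns an explicit linear estimate in the real modulus into convergence along the punctured
    neighbourhoods of 0. *)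
Lemma cvg_dnbhs0_lipschitz (g : R[i] -> R[i]) (l : R[i]) (C d : R) : 0 < d ->
  (forall h, h != 0 -> N h < d -> N (g h - l) <= C * N h) ->
  g @ (0 : R[i])^' --> l.
Proof.
move=> d0 gl; apply/cvgrPdist_le => e e0.
(* A positive element of [R[i]] is real, by definition of the order. *)
have eE : e = (complex.Re e)%:C.
  by move: e0; rewrite ltcE /=; case: e => p q /= /andP[/eqP -> _].
have r0 : 0 < complex.Re e by move: e0; rewrite ltcE => /andP[].
pose r := Num.min d (complex.Re e / (`|C| + 1)).
have C1 : 0 < `|C| + 1 by rewrite ltr_wpDl.
have rr0 : 0 < r by rewrite lt_min d0 divr_gt0.
have rC : 0 < r%:C by rewrite ltcR.
apply: filterS (filterI (nbhs_dnbhs_neq (0 : R[i])) (@dnbhs0_lt R[i] R[i] _ rC)).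
move=> h [h0 /=]; rewrite [X in X < _]complex_normE ltcR => hr.
rewrite -opprB normrN complex_normE eE lecR.
have hd : N h < d by apply: lt_le_trans hr _; rewrite ge_min lexx.
apply: le_trans (gl _ h0 hd) _; apply: le_trans (ler_norm _) _.
rewrite normrM (ger0_norm (normc_ge0 h)).
have : N h < complex.Re e / (`|C| + 1).
  by apply: lt_le_trans hr _; rewrite ge_min lexx orbT.
rewrite ltr_pdivlMr// => /ltW; apply: le_trans; rewrite mulrC ler_wpM2l ?normc_ge0//.
by rewrite lerDl.
Qed.

End HalfPlaneFixedPoint.

(** * Injectivity and surjectivity of the F-transform *)

Section FTransformInverse.
Variables (R : realType) (mu : probability R R).
Hypothesis mu_sq : mu.-integrable setT (fun x : R => ((x ^+ 2)%:E)%E).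
Implicit Types (u v w : R[i]) (t : R).
Local Notation N := Normc.normc.
Local Notation F := (F_transform mu).
Local Notation m := (meas_mean mu).
Local Notation s2 := (meas_variance mu).

(** If [u] and [v] differ, the difference formula forces [E (k u * k v) = -1], whereas its modulus
    is at most [s2 / t^2 < 1]. *)
Lemma F_transform_inj t u v : 0 < t -> s2 < t ^+ 2 ->
  t <= complex.Im u -> t <= complex.Im v -> F u = F v -> u = v.
Proof.
move=> t0 st tu tv Fuv; have u0 := lt_le_trans t0 tu; have v0 := lt_le_trans t0 tv.
have := F_transformB mu_sq u0 v0; rewrite Fuv subrr => /esym/eqP.
rewrite mulf_eq0 subr_eq0 => /orP[/eqP //|e0].
have := normc_cexpect_centeredM mu_sq t0 tu tv; move: e0.
rewrite addrC addr_eq0 => /eqP ->; rewrite normcN Normc.normc1.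
by rewrite ler_pdivlMr ?exprn_gt0// mul1r leNgt st.
Qed.

Lemma F_transform_surj w : 2 * Num.sqrt s2 < complex.Im w ->
  exists2 u, complex.Im w / 2 <= complex.Im u & F u = w.
Proof.
move=> hw; pose t := complex.Im w / 2.
have t0 : 0 < t by have := sqrtr_ge0 s2; rewrite /t; lra.
have s20 := meas_variance_ge0 mu.
have st : s2 < t ^+ 2.
  rewrite -(sqr_sqrtr s20) ltr_pXn2r ?nnegrE ?sqrtr_ge0 ?(ltW t0)//.
  by rewrite /t; lra.
have [||u v|u ut Tu] := @half_plane_fixed_point R (fun u => w + u - F u) t (s2 / t ^+ 2).
- by rewrite divr_ge0 ?sqr_ge0//= ltr_pdivrMr ?exprn_gt0// mul1r.
(* The half-plane is preserved: the image has imaginary part at least [2 t - s2 / Im u >= t]. *)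
- move=> u tu; have u0 := lt_le_trans t0 tu.
  have := normc_residual_le mu_sq u0.
  have : s2 / complex.Im u <= t.
    by rewrite ler_pdivrMr//; apply: le_trans (ltW st) _; rewrite expr2 ler_wpM2l// ltW.
  have := le_trans (ler_norm _) (norm_Im_le (F u - u + m%:C)).
  rewrite !ImD !ImN addr0.
  have -> : complex.Im w = 2 * t by rewrite /t; field.
  lra.
- move=> tu tv; have u0 := lt_le_trans t0 tu; have v0 := lt_le_trans t0 tv.
  have -> : w + u - F u - (w + v - F v) = (u - v) - (F u - F v) by ring.
  rewrite (F_transformB mu_sq u0 v0) mulrDr mulr1 opprD addrA subrr add0r normcN.
  rewrite Normc.normcM mulrC ler_wpM2r ?normc_ge0//.
  exact: normc_cexpect_centeredM.
exists u => //; move: Tu => /eqP; rewrite addrAC -subr_eq0 addrK subr_eq0.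
by move=> /eqP.
Qed.

End FTransformInverse.

(** * Complex differentiability of a right inverse *)

Section FTransformInverseDerivative.
Variables (R : realType) (mu : probability R R).
Hypothesis mu_sq : mu.-integrable setT (fun x : R => ((x ^+ 2)%:E)%E).
Variable inv : R[i] -> R[i].
Local Notation N := Normc.normc.
Local Notation E := (cexpect mu).
Local Notation F := (F_transform mu).
Local Notation s2 := (meas_variance mu).
Hypothesis invP : forall w, 2 * Num.sqrt s2 < complex.Im w ->
  complex.Im w / 2 <= complex.Im (inv w) /\ F (inv w) = w.

(** With [v = inv (w + h)] and [u = inv w], the difference formula reads [h = (v - u) * B] where
    [B = (w + h) * w * A v], so the quotient is [1 / B]. The bound [|B| >= 1 - q] makes [inv]
    Lipschitz at [w], hence [B] tends to [w * w * A u]. *)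
Lemma cvg_inv_quotient w : 2 * Num.sqrt s2 < complex.Im w ->
  exists l : R[i], (fun h : R[i] => (inv (w + h) - inv w) / h) @ (0 : R[i])^' --> l.
Proof.
move=> hw; set u := inv w; pose A v := E (fun x => cauchy_kernel v x * cauchy_kernel u x).
set sg := Num.sqrt s2 in hw; have sg0 : 0 <= sg := sqrtr_ge0 s2.
have s2E : s2 = sg ^+ 2 by rewrite sqr_sqrtr// meas_variance_ge0.
(* As [Im w = 2 sg + 2 d], [|h| < d] leaves [Im (w + h) > 2 sg + d]; half of this is [t], which
   still exceeds [sg]. *)
pose d := (complex.Im w - 2 * sg) / 2; have d0 : 0 < d by rewrite /d; lra.
pose t := sg + d / 2; have t0 : 0 < t by rewrite /t; lra.
have wt h : N h < d -> t <= complex.Im (inv (w + h)) /\ F (inv (w + h)) = w + h.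
  move=> hd; have ih := le_lt_trans (norm_Im_le h) hd.
  have [hl hr] : 2 * sg + d < complex.Im (w + h) /\ 2 * sg < complex.Im (w + h).
    move: ih; rewrite ltr_norml ImD => /andP[ih _].
    by split; move: ih; rewrite /d; lra.
  have [h1 h2] := invP hr; split=> //; apply: le_trans h1; rewrite /t; lra.
have [ut uE] : t <= complex.Im u /\ F u = w.
  by have := wt 0; rewrite addr0 Normc.normc0; exact.
have u0 := lt_le_trans t0 ut.
pose q := s2 / t ^+ 2.
have q1 : 0 < 1 - q.
  by rewrite subr_gt0 ltr_pdivrMr ?exprn_gt0// mul1r s2E /t; nra.
have quot h : N h < d -> let v := inv (w + h) in
    [/\ t <= complex.Im v, h = (v - u) * ((w + h) * w * A v) &
        1 - q <= N ((w + h) * w * A v)].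
  move=> hd v; have [vt vE] := wt _ hd; have v0 := lt_le_trans t0 vt; split=> //.
    rewrite -vE -[X in F v * X]uE cexpect_centeredM// -F_transformB// vE uE.
    by rewrite addrC addKr.
  rewrite -vE -[X in F v * X]uE cexpect_centeredM//.
  set e := E _; have eq : N e <= q by exact: normc_cexpect_centeredM.
  have := normcD_le (1 + e) (- e); rewrite addrK Normc.normc1 normcN.
  by lra.
have [_ _ A0] : [/\ t <= complex.Im u, 0 = (u - u) * (w * w * A u) &
    1 - q <= N (w * w * A u)].
  by have := quot 0; rewrite addr0 Normc.normc0; exact.
(* Bounds [|B0 - B| / |h|]: use [|w + h| <= |w| + d], [|v - u| <= |h| / (1 - q)], the Lipschitz
   constant [t^-3] of [A] and [|A u| <= t^-2]. *)
pose K := N w * ((N w + d) * ((1 - q)^-1 * (t^-1 * t^-1 ^+ 2)) + t^-1 * t^-1).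
exists (w * w * A u)^-1.
apply: (@cvg_dnbhs0_lipschitz _ _ _ (K / (1 - q) ^+ 2) d) => // h h0 hd.
have [vt hE Bq] := quot _ hd; set v := inv (w + h) in vt hE Bq *.
have v0 := lt_le_trans t0 vt.
set B := (w + h) * w * A v in hE Bq *; set B0 := w * w * A u in A0 *.
have nB : 0 < N B by exact: lt_le_trans Bq.
have nB0 : 0 < N B0 by exact: lt_le_trans A0.
have B_neq0 : B != 0 by apply: contraTneq nB => ->; rewrite Normc.normc0 ltxx.
have B0_neq0 : B0 != 0 by apply: contraTneq nB0 => ->; rewrite Normc.normc0 ltxx.
have -> : (v - u) / h = B^-1.
  have vu : v - u != 0 by apply: contraNneq h0 => vu; rewrite hE vu mul0r.
  by rewrite hE; field; rewrite vu B_neq0.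
have -> : B^-1 - B0^-1 = (B0 - B) / (B * B0) by field; rewrite B_neq0 B0_neq0.
have vuN : N (v - u) <= (1 - q)^-1 * N h.
  rewrite hE Normc.normcM mulrCA ler_peMr ?normc_ge0//.
  by rewrite mulrC ler_pdivlMr// mul1r.
have BB : N (B0 - B) <= K * N h.
  have -> : B0 - B = - (w * ((w + h) * (A v - A u) + h * A u)).
    by rewrite /B0 /B; ring.
  rewrite normcN Normc.normcM /K -[leRHS]mulrA ler_wpM2l ?normc_ge0//.
  apply: le_trans (normcD_le _ _) _; rewrite [leRHS]mulrDl lerD// Normc.normcM.
    rewrite -mulrA ler_pM ?normc_ge0//.
      by apply: le_trans (normcD_le _ _) _; rewrite lerD2l ltW.
    apply: le_trans (cexpect_kernelM_lip mu v0 u0) _.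
    rewrite mulrAC ler_pM ?normc_ge0 ?mulr_ge0 ?exprn_ge0 ?invr_ge0 ?(ltW v0) ?(ltW u0)//.
    by rewrite ler_pM ?exprn_ge0 ?invr_ge0 ?(ltW v0) ?(ltW u0)//
      ?lerXn2r ?nnegrE ?invr_ge0 ?(ltW u0) ?(ltW t0)// lef_pV2.
  rewrite mulrC ler_wpM2r ?normc_ge0//.
  apply: le_trans (normc_cexpect_kernelM_le mu u0 u0) _.
  by rewrite ler_pM ?invr_ge0 ?(ltW u0)// lef_pV2.
rewrite Normc.normcM Normc.normcV Normc.normcM mulrAC.
rewrite ler_pM ?normc_ge0 ?invr_ge0 ?mulr_ge0 ?normc_ge0//.
rewrite lef_pV2 ?posrE ?exprn_gt0 ?mulr_gt0// expr2.
by rewrite ler_pM ?(ltW q1).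
Qed.

End FTransformInverseDerivative.

(** * Extension of the inverse for the translated measure *)

Unset Implicit Arguments.
Set Strict Implicit.

(* mu has finite variance sigma^2, a real, b >= 2 sigma; nu = A_{a,b}(mu),
   i.e. F_nu(z) = F_mu(z - a + i b) + a - i b on C^+.  Then nu is in UI. *)
Theorem mainTheorem18 (R : realType) (mu nu : probability R R) (a b : R) :
  mu.-integrable setT (fun x : R => ((x ^+ 2)%:E)%E) ->
  2 * Num.sqrt (meas_variance mu) <= b ->
  (forall z : R[i], upper_half z ->
     F_transform nu z = F_transform mu (z - a%:C + (b *i)) + a%:C - (b *i)) ->
  UI nu.
Proof.
move=> mu_sq hb nuE; set m := meas_mean mu; set sg := Num.sqrt _ in hb.
have sg0 : 0 <= sg := sqrtr_ge0 _.
have s2E : meas_variance mu = sg ^+ 2 by rewrite sqr_sqrtr// meas_variance_ge0.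
have /choice[inv invP] : forall w : R[i], exists u, 2 * sg < complex.Im w ->
    complex.Im w / 2 <= complex.Im u /\ F_transform mu u = w.
  (* Below the threshold the requirement is vacuous and 0 is a dummy value. *)
  move=> w; have [hw|hw] := pselect (2 * sg < complex.Im w); last by exists 0.
  by have [u ut uE] := F_transform_surj mu_sq hw; exists u.
(* On the upper half-plane [F_transform nu] is [F_transform mu] conjugated by this shift, and [phi]
   conjugates [inv] likewise. The existential keeps [sh] opaque. *)
have [sh shE] : exists sh : R[i] -> R[i], forall z, sh z = z - a%:C + b *i.
  by exists (fun z => z - a%:C + b *i).
have Im_sh z : complex.Im (sh z) = complex.Im z + b.
  by rewrite shE !ImD /= subr0.
have Re_sh z : complex.Re (sh z) = complex.Re z - a.
  by rewrite shE !ReD /= addr0.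
pose phi z := inv (sh z) + a%:C - b *i.
have shphi z : sh (phi z) = inv (sh z).
  by rewrite shE /phi; ring.
have shP z : upper_half z -> 2 * sg < complex.Im (sh z).
  by rewrite Im_sh /upper_half /=; lra.
(* [phi z] lies within [sg] of [z + m]. For [y = Im z], landing in [cone 1 1] needs
   [y / 2 + |m| + sg <= y - sg] and [y - sg > 1]; both follow from [y > 2 |m| + 4 sg + 1]. *)
exists 2^-1, (2 * `|m| + 4 * sg + 1), 1, 1, phi; split.
  by have := normr_ge0 m; split => //; lra.
split.
- move=> z1 z2 /set_mem[_ h1] /set_mem[_ h2].
  rewrite !nuE; [|by rewrite /upper_half /=; lra..].
  rewrite -!shE => /addIr /addIr Fz.
  have : sh z1 = sh z2.
    (* On [cone 1 1] the shifted points have imaginary part above [1 + b >= 1 + 2 sg]. *)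
    apply: (F_transform_inj mu_sq (t := 1 + 2 * sg)) => //; [lra| |..].
    - by rewrite s2E; nra.
    - by rewrite Im_sh; lra.
    - by rewrite Im_sh; lra.
  by rewrite !shE => /addIr /addIr.
- move=> z [hre him].
  have m0 := normr_ge0 m.
  have z0 : upper_half z by rewrite /upper_half /=; lra.
  have [ut uE] := invP _ (shP _ z0); set u := inv _ in ut uE.
  have hw := shP _ z0.
  have u0 : 0 < complex.Im u by lra.
  have := normc_residual_le mu_sq u0; rewrite uE => res.
  (* Here [Im u >= Im (sh z) / 2 > sg]. *)
  have res_sg : meas_variance mu / complex.Im u <= sg.
    by rewrite ler_pdivrMr// s2E expr2 ler_wpM2l//; lra.
  have {}res := le_trans res res_sg.
  have := le_trans (norm_Re_le _) res; have := le_trans (norm_Im_le _) res.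
  rewrite !ImD !ReD ImN ReN Im_sh Re_sh /= addr0 -/m !ler_norml.
  move=> /andP[i1 i2] /andP[r1 r2].
  have [n1 n2] : - `|m| <= m /\ m <= `|m|.
    by split; [rewrite lerNl -normrN; exact: ler_norm|exact: ler_norm].
  have [pRe pIm] : complex.Re (phi z) = complex.Re u + a /\
      complex.Im (phi z) = complex.Im u - b.
    by rewrite /phi -/u !ReD !ImD ReN ImN /= subr0 addr0.
  move: hre; rewrite ltr_norml => /andP[h1 h2].
  have pc : cone 1 1 (phi z).
    by rewrite /cone /= pRe pIm mul1r ltr_norml; split; [apply/andP; split|]; lra.
  split => //; rewrite nuE; last by have [_] := pc; rewrite /upper_half /=; lra.
  by rewrite -shE shphi -/u uE shE; ring.
- move=> z z0; have [l hl] := cvg_inv_quotient mu_sq invP (shP _ z0).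
  (* Translations cancel: the quotient of [phi] at [z] is that of [inv] at [sh z]. *)
  exists l; apply: cvg_trans hl; apply: near_eq_cvg; apply: nearW => h.
  have -> : phi (z + h) = inv (sh z + h) + a%:C - b *i.
    by rewrite /phi !shE; congr (inv _ + _ - _); ring.
  by congr (_ / _); rewrite /phi; ring.
(* [inv] is injective where it is a right inverse of [F_transform mu]. *)
- move=> z1 z2 /set_mem z10 /set_mem z20 /addIr /addIr e.
  have [_ e1] := invP _ (shP _ z10); have [_ e2] := invP _ (shP _ z20).
  by have := e1; rewrite e e2 !shE => /addIr /addIr.
Qed.
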